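(* Let $n,N\ge 1$ be integers, let $\bm{c}_1,\dots,\bm{c}_N\in\mathbb{R}^n$, let $\bm{\Sigma}\in\mathbb{R}^{n\times n}$ be symmetric positive definite, and let $\bm{\Sigma}^{-1}=\bm{Q}\bm{D}\bm{Q}^\top$ be an eigendecomposition ($\bm{Q}$ orthogonal, $\bm{D}$ diagonal). Let $k(\bm{x},\bm{c})=\exp\big(-\tfrac12(\bm{x}-\bm{c})^\top\bm{\Sigma}^{-1}(\bm{x}-\bm{c})\big)$ be the multivariate Gaussian kernel, and for real weights $w_{i,j}$ ($1\le i\le N$, $1\le j\le n$) define $\bm{\phi}:\mathbb{R}^n\to\mathbb{R}^n$ by $$\bm{\phi}(\bm{x})=\bm{x}+\begin{bmatrix}\psi_1(\bm{x})\\ \vdots\\ \psi_n(\bm{x})\end{bmatrix},\qquad \psi_j(\bm{x})=\sum_{i=1}^N w_{i,j}\,k(\bm{x},\bm{c}_i).$$ If $$|w_{i,j}|<\frac{1}{nN\sum_{l=1}^{n}|Q_{j,l}|\,e^{-1/2}\sqrt{D_{l,l}}}\qquad\text{for all } i\in\{1,\dots,N\},\ j\in\{1,\dots,n\},$$ then $\bm{\phi}$ is a diffeomorphism.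
   Context: A diffeomorphism is a bijective smooth map whose inverse is also smooth; here the assertion concerns $\bm{\phi}$ as a map from $\mathbb{R}^n$ to $\mathbb{R}^n$. In $w_{i,j}$ the first index $i$ labels the kernel center $\bm{c}_i$ and the second index $j$ labels the output coordinate. *)

(* Defs.v *)
From HB Require Import structures.
From mathcomp Require Import all_boot all_order all_algebra.
From mathcomp Require Import all_classical all_reals all_analysis.

Set Implicit Arguments.
Unset Strict Implicit.
Unset Printing Implicit Defensive.

Import Order.TTheory GRing.Theory Num.Theory.
Import numFieldNormedType.Exports.

Local Open Scope classical_set_scope.
Local Open Scope ring_scope.

Definition posdef (R : realType) (n : nat) (A : 'M[R]_n) : Prop :=
  A \is symmetricmx /\
  forall x : 'cV[R]_n, x != 0 -> 0 < (x^T *m A *m x) 0 0.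

(* The partial derivative in the i-th coordinate is the directional derivative
   along the i-th standard basis vector [delta_mx i 0]. *)
Fixpoint is_Ck (R : realType) (n m k : nat) (f : 'cV[R]_n -> 'cV[R]_m) : Prop :=
  continuous f /\
  if k is k'.+1 then
    forall i : 'I_n,
      (forall x, derivable f x (delta_mx i 0)) /\
      is_Ck k' (fun x => 'D_(delta_mx i 0) f x)
  else True.

Definition smooth (R : realType) (n m : nat) (f : 'cV[R]_n -> 'cV[R]_m) : Prop :=
  forall k, is_Ck k f.

Definition diffeomorphism (R : realType) (n : nat)
    (f : 'cV[R]_n -> 'cV[R]_n) : Prop :=
  smooth f /\
  exists g : 'cV[R]_n -> 'cV[R]_n, [/\ cancel f g, cancel g f & smooth g].

Definition gaussian_kernel (R : realType) (n : nat) (Sigma : 'M[R]_n)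
    (x c : 'cV[R]_n) : R :=
  expR (- (2^-1 * ((x - c)^T *m invmx Sigma *m (x - c)) 0 0)).

Definition psi (R : realType) (n N : nat) (Sigma : 'M[R]_n)
    (c : 'I_N -> 'cV[R]_n) (w : 'I_N -> 'I_n -> R) (j : 'I_n)
    (x : 'cV[R]_n) : R :=
  \sum_(i < N) w i j * gaussian_kernel Sigma x (c i).

Definition phi (R : realType) (n N : nat) (Sigma : 'M[R]_n)
    (c : 'I_N -> 'cV[R]_n) (w : 'I_N -> 'I_n -> R)
    (x : 'cV[R]_n) : 'cV[R]_n :=
  x + \col_(j < n) psi Sigma c w j x.

(* Main.v *)
(* The difference quotients of the Gaussian satisfy, after diagonalising
   [Sigma^-1 = Q D Q^T] and using [s exp (- s^2 / 2) <= exp (- 1 / 2)],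
   [|k(x,c) - k(y,c)| <= sum_m b_m |x_m - y_m|] where [b_m] is the sum in the bound
   on [|w i m|].  In the norm [max_m b_m |x_m|] the map [psi] is therefore a
   contraction, so by Banach's fixed point theorem [phi = id + psi] is a
   homeomorphism, and its Jacobian is everywhere invertible by the same estimate.
   The inverse [g] has derivative [J(g y)^-1]; since the entries of [J] are built
   from polynomials and exponentials, [g] of class [C^k] makes this derivative of
   class [C^k], and smoothness of [g] follows by bootstrapping. *)
Require Import Defs.
From HB Require Import structures.
From mathcomp Require Import all_boot all_order all_algebra.
From mathcomp Require Import all_classical all_reals all_analysis.
From mathcomp Require Import ring lra.
Import Order.TTheory GRing.Theory Num.Theory.
Import numFieldNormedType.Exports.
Local Open Scope classical_set_scope.
Local Open Scope ring_scope.

Set Implicit Arguments.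
Unset Strict Implicit.

(** * Functions of class C^k *)

(* Scalar counterpart of [is_Ck]: products and inverses make sense here. *)
Fixpoint Ck (R : realType) (n : nat) (k : nat) (f : 'cV[R]_n -> R) : Prop :=
  continuous f /\
  if k is k'.+1 then
    forall i : 'I_n, (forall x, derivable f x (delta_mx i 0)) /\
      Ck k' (fun x => 'D_(delta_mx i 0) f x)
  else True.

Lemma cvg_mx (R : realFieldType) (T : Type) (F : set_system T) {FF : Filter F}
    (m n : nat) (f : T -> 'M[R]_(m, n)) (l : 'M[R]_(m, n)) :
  (forall i j, f x i j @[x --> F] --> l i j) ->
  f x @[x --> F] --> l.
Proof.
move=> fl; apply/cvgrPdist_le => /= e e0; near=> x.
rewrite /Num.Def.normr/= mx_normrE (bigmax_le _ (ltW e0))//= => i _.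
rewrite !mxE; move: i; near: x; apply: filter_forall => i.
exact: ((cvgrPdist_le _ _).1 (fl i.1 i.2)).
Unshelve. all: by end_near. Qed.

Lemma continuous_mx (R : realFieldType) (T : topologicalType) (m n : nat)
    (f : T -> 'M[R]_(m, n)) :
  (forall i j, continuous (fun x => f x i j)) -> continuous f.
Proof.
by move=> cf x; apply: (@cvg_mx R T (nbhs x) _ m n f (f x)) => i j; exact: cf.
Qed.

Lemma continuous_coord (R : realFieldType) (T : topologicalType) (m n : nat)
    (f : T -> 'M[R]_(m, n)) i j : continuous f -> continuous (fun x => f x i j).
Proof.
by move=> cf x; exact: (cvg_comp _ _ (cf x) (@coord_continuous R m n i j (f x))).
Qed.

Section Ck_theory.
Variables (R : realType) (n : nat).
Implicit Types (f g : 'cV[R]_n -> R) (k : nat).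

Lemma Ck_continuous k f : Ck k f -> continuous f.
Proof. by case: k => [|k] []. Qed.
Arguments Ck_continuous [k f] _ x t.

Lemma CkW k f : Ck k.+1 f -> Ck k f.
Proof.
elim: k f => [|k ih] f [fc fd]; split=> // i.
by have [dfi /ih] := fd i.
Qed.

Lemma Ck_derivable k f i x : Ck k.+1 f -> derivable f x (delta_mx i 0).
Proof. by move=> [_ /(_ i)[]]. Qed.
Arguments Ck_derivable [k f] i x _.

Lemma Ck_derive k f i : Ck k.+1 f -> Ck k ('D_(delta_mx i 0) f).
Proof. by move=> [_ /(_ i)[]]. Qed.

Lemma CkS k f : continuous f ->
    (forall i x, derivable f x (delta_mx i 0)) ->
    (forall i, Ck k ('D_(delta_mx i 0) f)) -> Ck k.+1 f.
Proof. by move=> fc df Df; split. Qed.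

Lemma Ck_cst k (a : R) : Ck k (fun _ : 'cV[R]_n => a).
Proof.
elim: k a => [|k ih] a; first by split=> //; exact: cst_continuous.
apply: CkS => [|i x|i]; [exact: cst_continuous|exact: derivable_cst|].
by rewrite (_ : 'D_ _ _ = fun=> 0) //; apply/funext => x; rewrite derive_cst.
Qed.

Lemma CkD k f g : Ck k f -> Ck k g -> Ck k (fun x => f x + g x).
Proof.
elim: k f g => [|k ih] f g Cf Cg.
  by split=> // x; exact: (continuousD (Ck_continuous Cf x) (Ck_continuous Cg x)).
apply: CkS => [x|i x|i].
- exact: (continuousD (Ck_continuous Cf x) (Ck_continuous Cg x)).
- by apply: derivableD; apply: Ck_derivable; eassumption.
- rewrite (_ : 'D_ _ _ = fun x => 'D_(delta_mx i 0) f x + 'D_(delta_mx i 0) g x).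
    by apply: ih; apply: Ck_derive.
  by apply/funext => x; rewrite deriveD//; apply: Ck_derivable; eassumption.
Qed.

Lemma CkM k f g : Ck k f -> Ck k g -> Ck k (fun x => f x * g x).
Proof.
elim: k f g => [|k ih] f g Cf Cg.
  by split=> // x; exact: (continuousM (Ck_continuous Cf x) (Ck_continuous Cg x)).
apply: CkS => [x|i x|i].
- exact: (continuousM (Ck_continuous Cf x) (Ck_continuous Cg x)).
- by apply: derivableM; apply: Ck_derivable; eassumption.
- rewrite (_ : 'D_ _ _ =
      fun x => f x * 'D_(delta_mx i 0) g x + g x * 'D_(delta_mx i 0) f x).
    by apply: CkD; apply: ih; by [apply: Ck_derive|apply: CkW].
  by apply/funext => x; rewrite deriveM//; apply: Ck_derivable; eassumption.
Qed.

Lemma Ck_sum k (I : Type) (r : seq I) (P : pred I) (F : I -> 'cV[R]_n -> R) :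
  (forall i, P i -> Ck k (F i)) -> Ck k (fun x => \sum_(i <- r | P i) F i x).
Proof.
move=> CF; elim: r => [|i r ih].
  by under eq_fun do rewrite big_nil; exact: Ck_cst.
under eq_fun do rewrite big_cons.
by have [Pi|] := boolP (P i); [apply: CkD ih; exact: CF|].
Qed.

Lemma Ck_prod k (I : Type) (r : seq I) (P : pred I) (F : I -> 'cV[R]_n -> R) :
  (forall i, P i -> Ck k (F i)) -> Ck k (fun x => \prod_(i <- r | P i) F i x).
Proof.
move=> CF; elim: r => [|i r ih].
  by under eq_fun do rewrite big_nil; exact: Ck_cst.
under eq_fun do rewrite big_cons.
by have [Pi|] := boolP (P i); [apply: CkM ih; exact: CF|].
Qed.

Lemma Ck_coord k (j : 'I_n) : Ck k (fun x : 'cV[R]_n => x j 0).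
Proof.
have dx i (x : 'cV[R]_n) :
    is_derive x (delta_mx i 0) (fun y : 'cV[R]_n => y j 0) ((delta_mx i 0 : 'cV[R]_n) j 0).
  have di : derivable id x (delta_mx i 0 : 'cV[R]_n) by exact: derivable_id.
  split; first exact: ((derivable_mxP _ _ _).1 di j 0).
  by have := derive_mx di; rewrite derive_id => /matrixP/(_ j 0); rewrite [RHS]mxE => <-.
case: k => [|k]; first by split=> // x; exact: coord_continuous.
apply: CkS => [x|i x|i]; [exact: coord_continuous|by have [] := dx i x|].
rewrite (_ : 'D_ _ _ = fun=> (delta_mx i 0 : 'cV[R]_n) j 0); first exact: Ck_cst.
by apply/funext => x; have [] := dx i x.
Qed.

(** Restricting to the line through [x] in direction [v] makes the one-variable chain rule
    available, which gives the derivative of [expR (f y)] below. *)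
Lemma is_derive1P f (x v : 'cV[R]_n) (a : R) :
  is_derive x v f a <-> is_derive (0 : R) 1 (fun h : R => f (h *: v + x)) a.
Proof.
have dE : 'D_v f x = 'D_1 (fun h : R => f (h *: v + x)) 0.
  rewrite /derive; set g1 := fun h => h^-1 *: _; set g2 := fun h => h^-1 *: _.
  suff -> : g1 = g2 by [].
  by rewrite funeqE /g1 /g2 => h /=; rewrite addr0 scale0r add0r [_%:A]mulr1.
split=> -[df fE]; apply: DeriveDef.
- exact/(derivable1P f x v).
- by rewrite -dE.
- exact/(derivable1P f x v).
- by rewrite dE.
Qed.

Lemma is_derive_expR_comp f (x v : 'cV[R]_n) (a : R) : is_derive x v f a ->
  is_derive x v (fun y => expR (f y)) (expR (f x) * a).
Proof.
move=> /is_derive1P d1; apply/is_derive1P.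
have := @is_derive1_comp R expR (fun h : R => f (h *: v + x)) 0 _ _
  (is_derive_expR _) d1.
by rewrite scale0r add0r.
Qed.

Lemma Ck_expR k f : Ck k f -> Ck k (fun x => expR (f x)).
Proof.
have cexp g : continuous g -> continuous (fun x => expR (g x)).
  by move=> cg x; apply: continuous_comp; [exact: cg|exact: continuous_expR].
elim: k f => [|k ih] f Cf; first by split=> //; exact/cexp/(Ck_continuous Cf).
have dx i x : is_derive x (delta_mx i 0) (fun y => expR (f y))
    (expR (f x) * 'D_(delta_mx i 0) f x).
  exact/is_derive_expR_comp/derivableP/(Ck_derivable i x Cf).
apply: CkS => [|i x|i].
- exact/cexp/(Ck_continuous Cf).
- by have [] := dx i x.
- rewrite (_ : 'D_ _ _ = fun x => expR (f x) * 'D_(delta_mx i 0) f x).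
    by apply: CkM; [exact/ih/CkW|exact: Ck_derive].
  by apply/funext => x; have [] := dx i x.
Qed.

(** The derivative of [f^-1] is [- f^-1 * f^-1 * f'], which involves only [f^-1] and [f'], so
    induction on [k] with the product rule closes. *)
Lemma CkV k f : (forall x, f x != 0) -> Ck k f -> Ck k (fun x => (f x)^-1).
Proof.
move=> f0; elim: k => [|k ih] Cf.
  by split=> // x; exact: (continuousV (f0 x) (Ck_continuous Cf x)).
apply: CkS => [|i x|i].
- by move=> x; exact: (continuousV (f0 x) (Ck_continuous Cf x)).
- by apply: derivableV => //; apply: Ck_derivable; eassumption.
- rewrite (_ : 'D_ _ _ =
      fun x => -1 * ((f x)^-1 * (f x)^-1) * 'D_(delta_mx i 0) f x).
    apply: CkM; last exact: Ck_derive.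
    by apply: CkM; [exact: Ck_cst|apply: CkM; exact/ih/CkW].
  apply/funext => x; rewrite deriveV//; last exact: (Ck_derivable i x Cf).
  by rewrite expr2 invfM mulN1r.
Qed.

(** Limits and derivatives of vector-valued maps are taken entrywise, so everything reduces to the
    scalar predicate [Ck]. *)
Lemma is_Ck_coord m k (f : 'cV[R]_n -> 'cV[R]_m) :
  (forall j, Ck k (fun x => f x j 0)) -> is_Ck k f.
Proof.
have cf (h : 'cV[R]_n -> 'cV[R]_m) l : (forall j, Ck l (fun x => h x j 0)) -> continuous h.
  by move=> hC; apply: continuous_mx => j i; rewrite (ord1 i); exact: Ck_continuous.
elim: k f => [|k ih] f Cf; split=> //; try exact: cf Cf.
move=> i.
have df x : derivable f x (delta_mx i 0).
  by apply/derivable_mxP => j l; rewrite (ord1 l); exact: Ck_derivable (Cf j).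
split=> //; apply: ih => j.
under eq_fun do rewrite derive_mx// mxE.
exact: Ck_derive (Cf j).
Qed.

End Ck_theory.

(** * Inverting a contractive perturbation of the identity *)

Lemma contraction_fixpoint_exists (R : realType) (V : completeNormedModType R)
    (q : R) (f : V -> V) : 0 <= q -> q < 1 ->
  (forall x y, `|f x - f y| <= q * `|x - y|) -> exists x, x = f x.
Proof.
move=> q0 q1 fq.
pose F : {fun [set: V] >-> [set: V]} := HB.pack f (isFun.Build V V setT setT f (fun _ _ => I)).
have [x _ xE] : exists2 p, [set: V] p & p = F p.
  apply: banach_fixed_point; [|exact: closedT|by exists 0].
  by exists (NngNum q0); split => //= -[x y] _; exact: fq.
by exists x.
Qed.

(** Solving [x + f x = y] means finding a fixed point of [x |-> y - f x], again a contraction. The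
    lower bound [(1 - q) * |x - y|] on distances between images gives injectivity and makes the
    inverse Lipschitz. *)
Lemma id_add_contraction_inverse (R : realType) (V : completeNormedModType R)
    (q : R) (f : V -> V) : 0 <= q -> q < 1 ->
  (forall x y, `|f x - f y| <= q * `|x - y|) ->
  exists g : V -> V, [/\ cancel (fun x => x + f x) g,
    cancel g (fun x => x + f x) & continuous g].
Proof.
move=> q0 q1 fq.
have surj y : exists x, x + f x = y.
  have [a b|x xE] := @contraction_fixpoint_exists R V q (fun x => y - f x) q0 q1.
    by rewrite opprB addrC subrKA distrC; exact: fq.
  by exists x; rewrite {1}xE subrK.
have [g gK] := choice surj.
have expand x y : (1 - q) * `|x - y| <= `|(x + f x) - (y + f y)|.
  rewrite mulrBl mul1r lerBlDr; have := fq x y.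
  have -> : x + f x - (y + f y) = (x - y) + (f x - f y) by rewrite opprD addrACA.
  have := lerB_normD (x - y) (f x - f y); lra.
have q1' : 0 < 1 - q by rewrite subr_gt0.
exists g; split => // [x|y].
  have := expand (g (x + f x)) x; rewrite gK subrr normr0 pmulr_rle0//.
  by rewrite normr_le0 subr_eq0 => /eqP.
apply/cvgrPdist_le => e e0; near=> z.
rewrite -(ler_pM2l q1'); apply: le_trans (expand _ _) _; rewrite !gK.
near: z; apply: cvgr_dist_le; [exact: cvg_id|exact: mulr_gt0].
Unshelve. all: by end_near. Qed.

(** * Determinants, inverse matrices and the regularity of an inverse map *)

Lemma cvg_det (R : realFieldType) (T : Type) (F : set_system T) {FF : Filter F}
    (n : nat) (A : T -> 'M[R]_n) (B : 'M[R]_n) :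
  (forall i j, A x i j @[x --> F] --> B i j) ->
  \det (A x) @[x --> F] --> \det B.
Proof.
move=> AB; apply: cvg_big => [|s _]; first exact: add_continuous.
apply: cvgM; first exact: cvg_cst.
by apply: cvg_big => [|i _]; [exact: mul_continuous|exact: AB].
Qed.

Lemma cvg_cofactor (R : realFieldType) (T : Type) (F : set_system T) {FF : Filter F}
    (n : nat) (A : T -> 'M[R]_n) (B : 'M[R]_n) i j :
  (forall i j, A x i j @[x --> F] --> B i j) ->
  cofactor (A x) i j @[x --> F] --> cofactor B i j.
Proof.
move=> AB; apply: cvgM; first exact: cvg_cst.
by apply: cvg_det => k l; rewrite !mxE; under eq_fun do rewrite !mxE; exact: AB.
Qed.

Lemma Ck_det (R : realType) (n m k : nat) (A : 'cV[R]_n -> 'M[R]_m) :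
  (forall i j, Ck k (fun x => A x i j)) -> Ck k (fun x => \det (A x)).
Proof.
move=> CA; apply: Ck_sum => s _; apply: CkM; first exact: Ck_cst.
by apply: Ck_prod => i _; exact: CA.
Qed.

(** By Cramer's rule each entry is a cofactor divided by the nonvanishing determinant. *)
Lemma Ck_invmx (R : realType) (n m k : nat) (A : 'cV[R]_n -> 'M[R]_m) i j :
  (forall x, A x \in unitmx) -> (forall i j, Ck k (fun x => A x i j)) ->
  Ck k (fun x => invmx (A x) i j).
Proof.
move=> uA CA.
rewrite (_ : (fun _ => _) = fun x => (\det (A x))^-1 * cofactor (A x) j i).
  apply: CkM; first by apply: CkV (Ck_det CA) => x; rewrite -unitfE -unitmxE.
  apply: CkM; [exact: Ck_cst|apply: Ck_det => a b].
  by under eq_fun do rewrite !mxE; exact: CA.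
by apply/funext => x; rewrite /invmx uA !mxE.
Qed.

Lemma unitmx_inj (K : fieldType) (n : nat) (A : 'M[K]_n) :
  (forall v : 'cV[K]_n, A *m v = 0 -> v = 0) -> A \in unitmx.
Proof.
move=> A0; rewrite -unitmx_tr -row_free_unit -kermx_eq0; apply/rowV0P => u.
move/sub_kermxP => /(congr1 trmx); rewrite trmx_mul trmxK trmx0 => /A0.
by move=> /(congr1 trmx); rewrite trmxK trmx0.
Qed.

(* Caratheodory's form of differentiability: the difference of [f] factors through a
   matrix [M x x'] that is continuous in [x'] at [x], so [M x x] is the Jacobian. *)
Lemma is_derive_inverse (R : realType) (n : nat) (f g : 'cV[R]_n -> 'cV[R]_n)
    (M : 'cV[R]_n -> 'cV[R]_n -> 'M[R]_n) (y v : 'cV[R]_n) :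
  cancel g f -> continuous g ->
  (forall x x', f x' - f x = M x x' *m (x' - x)) ->
  (forall i j, M (g y) x i j @[x --> g y] --> M (g y) (g y) i j) ->
  M (g y) (g y) \in unitmx ->
  is_derive y v g (invmx (M (g y) (g y)) *m v).
Proof.
move=> gK cg fM cM uM.
(* [N h] times the increment of [g] from [y] to [h *: v + y] is exactly [h *: v], because [f] undoes
   [g]. *)
set J := M (g y) (g y); pose N h := M (g y) (g (h *: v + y)).
have cN i j : N h i j @[h --> (0 : R)^'] --> J i j.
  apply: (cvg_comp (fun h : R => g (h *: v + y)) (fun x => M (g y) x i j)) (cM i j).
  apply: (cvg_comp (fun h : R => h *: v + y) g) (cg y).
  apply: cvg_within_filter.
  rewrite -{2}(add0r y) -(scale0r v); apply: cvgD; last exact: cvg_cst.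
  by apply: cvgZ; [exact: cvg_id|exact: cvg_cst].
have cD : \det (N h) @[h --> (0 : R)^'] --> \det J by exact: cvg_det.
have J0 : \det J != 0 by rewrite -unitfE -unitmxE.
have Q : h^-1 *: (g (h *: v + y) - g y) @[h --> (0 : R)^'] --> invmx J *m v.
  (* For small [h] the determinant of [N h] is nonzero. The inverse is written with the adjugate,
     whose entries are polynomials in those of [N h] and therefore converge. *)
  have near_eq : \forall h \near (0 : R)^',
      (\det (N h))^-1 *: (\adj (N h) *m v) = h^-1 *: (g (h *: v + y) - g y).
    near=> h.
    have h0 : h != 0 by near: h; exact: nbhs_dnbhs_neq.
    have D0 : \det (N h) != 0.
      by near: h; apply: cvgr_neq0 cD J0.
    have uN : N h \in unitmx by rewrite unitmxE unitfE.
    have : N h *m (g (h *: v + y) - g y) = h *: v.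
      by rewrite -fM !gK addrK.
    move=> /(congr1 (mulmx (invmx (N h)))); rewrite mulKmx// => ->.
    by rewrite -scalemxAr scalerA mulVf// scale1r /invmx uN -scalemxAl.
  apply: cvg_trans (near_eq_cvg near_eq) _.
  rewrite /invmx uM -scalemxAl; apply: cvgZ; first exact: cvgV.
  apply: cvg_mx => i j; rewrite mxE; under eq_fun do rewrite mxE.
  apply: cvg_big => [|k _]; first exact: add_continuous.
  apply: cvgM; last exact: cvg_cst.
  by rewrite mxE; under eq_fun do rewrite mxE; exact: cvg_cofactor.
by apply: DeriveDef; [exact: cvgP Q|exact: cvg_lim Q].
Unshelve. all: by end_near. Qed.

(** Induction on [k]: the partial derivatives of [g] are entries of the inverse Jacobian at [g y],
    so they inherit the class of [g]. The last hypothesis acts as the chain rule for the Jacobian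
    composed with [g]. *)
Lemma Ck_inverse (R : realType) (n : nat) (f g : 'cV[R]_n -> 'cV[R]_n)
    (M : 'cV[R]_n -> 'cV[R]_n -> 'M[R]_n) :
  cancel g f -> continuous g ->
  (forall x x', f x' - f x = M x x' *m (x' - x)) ->
  (forall y i j, M y x i j @[x --> y] --> M y y i j) ->
  (forall x, M x x \in unitmx) ->
  (forall k, (forall j, Ck k (fun y => g y j 0)) ->
    forall i j, Ck k (fun y => M (g y) (g y) i j)) ->
  forall k j, Ck k (fun y => g y j 0).
Proof.
move=> gK cg fM cM uM CM; elim=> [|k ih] j.
  by split=> //; exact: continuous_coord.
have dg i y : is_derive y (delta_mx i 0) g (invmx (M (g y) (g y)) *m delta_mx i 0).
  exact: is_derive_inverse.
have dgj i y : is_derive y (delta_mx i 0) (fun y => g y j 0) (invmx (M (g y) (g y)) j i).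
  have [df dE] := dg i y; apply: DeriveDef; first exact: ((derivable_mxP _ _ _).1 df).
  have := derive_mx df; rewrite dE => /matrixP/(_ j 0); rewrite [RHS]mxE => <-.
  by rewrite -colE mxE.
apply: CkS => [|i y|i].
- exact: continuous_coord.
- by have [] := dgj i y.
- rewrite (_ : 'D_ _ _ = fun y => invmx (M (g y) (g y)) j i).
    by apply: Ck_invmx => //; exact: CM.
  by apply/funext => y; have [] := dgj i y.
Qed.

(** * Gaussian estimates *)

Definition qform (R : realType) (n : nat) (S : 'M[R]_n) (u v : 'cV[R]_n) : R :=
  (u^T *m S *m v) 0 0.

Section qform_theory.
Variables (R : realType) (n : nat) (S : 'M[R]_n).
Implicit Types u v z : 'cV[R]_n.

Lemma qformDl u v z : qform S (u + v) z = qform S u z + qform S v z.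
Proof. by rewrite /qform linearD/= !mulmxDl mxE. Qed.

Lemma qformDr u v z : qform S u (v + z) = qform S u v + qform S u z.
Proof. by rewrite /qform mulmxDr mxE. Qed.

Lemma qformZl a u v : qform S (a *: u) v = a * qform S u v.
Proof. by rewrite /qform linearZ/= -!scalemxAl mxE. Qed.

Lemma qformZr a u v : qform S u (a *: v) = a * qform S u v.
Proof. by rewrite /qform -scalemxAr mxE. Qed.

Lemma qformNl u v : qform S (- u) v = - qform S u v.
Proof. by rewrite -scaleN1r qformZl mulN1r. Qed.

Lemma qformNr u v : qform S u (- v) = - qform S u v.
Proof. by rewrite -scaleN1r qformZr mulN1r. Qed.

Hypothesis Ssym : S^T = S.

Lemma qformC u v : qform S u v = qform S v u.
Proof.
transitivity ((u^T *m S *m v)^T 0 0); first by rewrite mxE.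
by rewrite !trmx_mul trmxK Ssym mulmxA.
Qed.

(** Turns the exponent of the Gaussian along a line into a polynomial in [t] that can be
    differentiated directly. *)
Lemma qform_line y v (t : R) : qform S (y + t *: v) (y + t *: v) =
  qform S y y + 2 * qform S y v * t + qform S v v * t ^+ 2.
Proof. rewrite !(qformDl, qformDr, qformZl, qformZr) (qformC v y); ring. Qed.

Lemma qformB x y : qform S x x - qform S y y = qform S (x + y) (x - y).
Proof. rewrite !(qformDl, qformDr, qformNr) (qformC x y); ring. Qed.

Lemma qform_rowE u v : qform S u v = \sum_m (u^T *m S) 0 m * v m 0.
Proof. by rewrite /qform mxE. Qed.

End qform_theory.

Lemma qform_diag (R : realType) (n : nat) (Q D : 'M[R]_n) (u v : 'cV[R]_n) :
  is_diag_mx D -> qform (Q *m D *m Q^T) u v =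
  \sum_l D l l * (Q^T *m u) l 0 * (Q^T *m v) l 0.
Proof.
move=> /is_diag_mxP hD.
have DE : D = diag_mx (\row_l D l l).
  apply/matrixP => i j; rewrite !mxE; case: eqVneq => [->|ij]; rewrite ?mulr1n//.
  by rewrite mulr0n hD.
rewrite /qform {1}DE !mulmxA -[_ *m Q^T *m v]mulmxA mul_mx_diag mxE.
apply: eq_bigr => l _; rewrite !mxE mulrC [RHS]mulrC; congr (_ * _).
rewrite mulrC; congr (_ * _).
by apply: eq_bigr => m _; rewrite !mxE mulrC.
Qed.

(** Since [2 * |s| <= 1 + s ^+ 2] and [1 + t <= expR t], taking [t = (s ^+ 2 - 1) / 2] gives
    [|s| <= expR t]; then multiply by the Gaussian factor. *)
Lemma mul_expR_sqr_le (R : realType) (s : R) :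
  `|s| * expR (- (2^-1 * s ^+ 2)) <= expR (- 2^-1).
Proof.
have h := expR_ge1Dx (2^-1 * s ^+ 2 - 2^-1).
rewrite (_ : expR (- 2^-1) =
  expR (2^-1 * s ^+ 2 - 2^-1) * expR (- (2^-1 * s ^+ 2))); last first.
  by rewrite -expRD; congr expR; ring.
apply: ler_wpM2r; first exact: expR_ge0.
apply: le_trans h; rewrite -(real_normK (num_real s)).
by have := sqr_ge0 (`|s| - 1); lra.
Qed.

(** A uniform bound on the [j]-th partial derivative of the Gaussian. *)
Definition coef_bound (R : realType) (n : nat) (Q D : 'M[R]_n) (j : 'I_n) : R :=
  \sum_(l < n) `|Q j l| * expR (- 2^-1) * Num.sqrt (D l l).

Section gaussian_bound.
Variables (R : realType) (n : nat) (Q D : 'M[R]_n).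
Hypotheses (hD : is_diag_mx D) (D0 : forall l, 0 <= D l l).
Let S := Q *m D *m Q^T.
Let B := coef_bound Q D.

(** In eigencoordinates [a] of [z] and [b] of [v] the form is a sum over [l]. Each summand is
    bounded by the scalar estimate at [s = Num.sqrt (D l l) * a l], after which [b l] is expanded in
    the entries of [v] and the sums are exchanged. *)
Lemma qform_gaussian_le (z v : 'cV[R]_n) :
  `|qform S z v| * expR (- (2^-1 * qform S z z)) <= \sum_m B m * `|v m 0|.
Proof.
rewrite !qform_diag//; set a := fun l => (Q^T *m z) l 0.
pose b l := (Q^T *m v) l 0.
pose E := expR (- (2^-1 * \sum_l D l l * a l * a l)).
have term l : `|D l l * a l * b l| * E <=
    \sum_m `|Q m l| * expR (- 2^-1) * Num.sqrt (D l l) * `|v m 0|.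
  have sE : D l l = Num.sqrt (D l l) ^+ 2 by rewrite sqr_sqrtr.
  (* The other summands of the exponent are nonnegative, so keeping only index [l] can only increase
     the exponential. *)
  have EE : E <= expR (- (2^-1 * (Num.sqrt (D l l) * a l) ^+ 2)).
    rewrite ler_expR lerN2 ler_pM2l ?invr_gt0// exprMn -sE.
    rewrite (bigD1 l)//= expr2 mulrA lerDl sumr_ge0// => k _.
    by rewrite -mulrA mulr_ge0// -expr2 sqr_ge0.
  apply: (@le_trans _ _ (Num.sqrt (D l l) * expR (- 2^-1) * `|b l|)).
    have := mul_expR_sqr_le (Num.sqrt (D l l) * a l).
    move=> /(le_trans (ler_wpM2l (normr_ge0 _) EE)) h.
    rewrite (_ : `|_| * E = Num.sqrt (D l l) * `|b l| *
      (`|Num.sqrt (D l l) * a l| * E)).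
      rewrite [leRHS]mulrAC; apply: ler_wpM2l h.
      by rewrite mulr_ge0// sqrtr_ge0.
    rewrite {1}sE !normrM ?normrX !(ger0_norm (sqrtr_ge0 _)); ring.
  rewrite (_ : \sum_m _ = Num.sqrt (D l l) * expR (- 2^-1) *
      \sum_m `|Q m l| * `|v m 0|); last first.
    by rewrite mulr_sumr; apply: eq_bigr => m _; ring.
  apply: ler_wpM2l; first by rewrite mulr_ge0 ?expR_ge0 ?sqrtr_ge0.
  rewrite /b mxE (le_trans (ler_norm_sum _ _ _))//.
  by apply: ler_sum => m _; rewrite mxE normrM.
apply: (@le_trans _ _ (\sum_l `|D l l * a l * b l| * E)).
  by rewrite -mulr_suml ler_wpM2r ?expR_ge0// ler_norm_sum.
apply: (le_trans (ler_sum _ (fun l _ => term l))).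
rewrite exchange_big/=; apply: ler_sum => m _.
by rewrite /B /coef_bound mulr_suml.
Qed.
End gaussian_bound.

(** * The Gaussian: Lipschitz estimate and Caratheodory factor *)

Definition gaussian (R : realType) (n : nat) (S : 'M[R]_n) (z : 'cV[R]_n) : R :=
  expR (- (2^-1 * qform S z z)).

(** Mean value theorem on the segment from [y] to [x]: the derivative at the intermediate point is
    bounded by [qform_gaussian_le], uniformly in that point. *)
Lemma gaussian_lipschitz (R : realType) (n : nat) (Q D : 'M[R]_n)
    (x y : 'cV[R]_n) :
  is_diag_mx D -> (forall l, 0 <= D l l) -> (Q *m D *m Q^T)^T = Q *m D *m Q^T ->
  `|gaussian (Q *m D *m Q^T) x - gaussian (Q *m D *m Q^T) y| <=
    \sum_m coef_bound Q D m * `|(x - y) m 0|.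
Proof.
move=> hD D0 Ssym; set S := Q *m D *m Q^T; set v := x - y.
pose p (t : R) := qform S y y + 2 * qform S y v * t + qform S v v * t ^+ 2.
pose f (t : R) := expR (- (2^-1 * p t)).
have fE t : f t = gaussian S (y + t *: v) by rewrite /gaussian qform_line.
pose df (t : R) := f t * - qform S (y + t *: v) v.
have fd (t : R) : is_derive t 1 f (df t).
  apply: (@is_derive1_comp R expR (fun t : R => - (2^-1 * p t))).
  rewrite /p; apply: is_derive_eq.
  by rewrite qformDl qformZl /GRing.scale /=; field.
have fc : {within `[0, 1], continuous f}.
  apply: continuous_subspaceT => t.
  by apply/differentiable_continuous/derivable1_diffP; have [] := fd t.
have [c _] := MVT ltr01 (fun t _ => fd t) fc.
rewrite !fE scale1r scale0r addr0 /v subrKC subr0 mulr1 => ->.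
rewrite /df fE normrM normrN mulrC ger0_norm; last exact: expR_ge0.
exact: qform_gaussian_le.
Qed.

(** The value at 0 is the derivative of [expR] there, which makes the quotient continuous at 0. *)
Definition expR_quot (R : realType) (h : R) : R :=
  if h == 0 then 1 else (expR h - 1) / h.

Lemma expR_quotE (R : realType) (a b : R) :
  expR b - expR a = expR a * expR_quot (b - a) * (b - a).
Proof.
rewrite /expR_quot subr_eq0; case: eqVneq => [->|ab]; first by rewrite !subrr mulr0.
by rewrite -mulrA divfK ?subr_eq0// mulrBr mulr1 -expRD subrKC.
Qed.

Lemma cvg_expR_quot (R : realType) : @expR_quot R h @[h --> 0] --> (1 : R).
Proof.
have e0 : expR_quot 0 = 1 :> R by rewrite /expR_quot eqxx.
rewrite -[X in _ --> X]e0; apply/continuous_withinNx; rewrite e0.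
have [d dE] := is_derive_expR (0 : R).
move: d; rewrite /derivable -[X in _ --> X]expR0.
rewrite -[in X in _ -> X]dE => d; apply: cvg_trans d; apply: near_eq_cvg.
near=> h.
have h0 : h != 0 by near: h; exact: nbhs_dnbhs_neq.
by rewrite /= /expR_quot (negPf h0) addr0 expR0 [_%:A]mulr1 mulrC.
Unshelve. all: by end_near. Qed.

Lemma gaussian_kernelE (R : realType) (n : nat) (Sigma : 'M[R]_n)
    (x c : 'cV[R]_n) : gaussian_kernel Sigma x c = gaussian (invmx Sigma) (x - c).
Proof. by []. Qed.

(** The entries of a row factor of the increment of the Gaussian: [expR_quot] handles the
    exponential, and the exponent changes by [- 2^-1 * qform S (x' + x) (x' - x)] when [S] is
    symmetric. At [x' = x] it is the gradient. *)
Definition gaussian_slope (R : realType) (n : nat) (S : 'M[R]_n)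
    (x x' : 'cV[R]_n) (m : 'I_n) : R :=
  gaussian S x * expR_quot (2^-1 * qform S x x - 2^-1 * qform S x' x') *
  (- 2^-1 * ((x' + x)^T *m S) 0 m).

Lemma gaussian_slopeE (R : realType) (n : nat) (S : 'M[R]_n) (x x' : 'cV[R]_n) :
  S^T = S -> gaussian S x' - gaussian S x =
  \sum_m gaussian_slope S x x' m * (x' - x) m 0.
Proof.
move=> Ssym; rewrite /gaussian expR_quotE opprK [- _ + _]addrC.
under eq_bigr do rewrite /gaussian_slope -!mulrA.
rewrite -!mulr_sumr -qform_rowE -qformB// /gaussian; ring.
Qed.

Lemma gaussian_slope_diag (R : realType) (n : nat) (S : 'M[R]_n)
    (x : 'cV[R]_n) (m : 'I_n) :
  gaussian_slope S x x m = - (gaussian S x * (x^T *m S) 0 m).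
Proof.
rewrite /gaussian_slope subrr /expR_quot eqxx mulr1 linearD/= mulmxDl mxE.
by field.
Qed.

Section Ck_gaussian.
Variables (R : realType) (n k : nat) (S : 'M[R]_n) (g : 'cV[R]_n -> 'cV[R]_n).
Hypothesis Cg : forall j, Ck k (fun y => g y j 0).

Lemma Ck_trmulmx m : Ck k (fun y => ((g y)^T *m S) 0 m).
Proof.
under eq_fun do rewrite mxE; apply: Ck_sum => l _; apply: CkM; last exact: Ck_cst.
by under eq_fun do rewrite mxE; exact: Cg.
Qed.

Lemma Ck_qform : Ck k (fun y => qform S (g y) (g y)).
Proof.
under eq_fun do rewrite qform_rowE.
by apply: Ck_sum => m _; apply: CkM; [exact: Ck_trmulmx|exact: Cg].
Qed.

Lemma Ck_gaussian : Ck k (fun y => gaussian S (g y)).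
Proof.
apply: Ck_expR; under eq_fun do rewrite -mulNr.
by apply: CkM Ck_qform; exact: Ck_cst.
Qed.

Lemma Ck_gaussian_slope_diag m : Ck k (fun y => gaussian_slope S (g y) (g y) m).
Proof.
under eq_fun do rewrite gaussian_slope_diag -mulN1r.
apply: CkM; first exact: Ck_cst.
by apply: CkM; [exact: Ck_gaussian|exact: Ck_trmulmx].
Qed.

End Ck_gaussian.

Lemma cvg_gaussian_slope (R : realType) (n : nat) (S : 'M[R]_n)
    (x : 'cV[R]_n) (m : 'I_n) :
  gaussian_slope S x x' m @[x' --> x] --> gaussian_slope S x x m.
Proof.
have cq : 2^-1 * qform S x x - 2^-1 * qform S x' x' @[x' --> x] --> 0.
  rewrite -[X in _ --> X](subrr (2^-1 * qform S x x)).
  apply: (Ck_continuous (k := 0)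
    (f := fun x' => 2^-1 * qform S x x - 2^-1 * qform S x' x')).
  apply: CkD; first exact: Ck_cst.
  under eq_fun do rewrite -mulNr.
  apply: CkM; first exact: Ck_cst.
  by apply: (Ck_qform S (g := id)) => j; exact: Ck_coord.
have cE := cvg_comp _ _ cq (@cvg_expR_quot R).
have cL : ((x' + x)^T *m S) 0 m @[x' --> x] --> ((x + x)^T *m S) 0 m.
  apply: (Ck_continuous (Ck_trmulmx (k := 0) S (g := fun x' => x' + x) _ m)) => j.
  under eq_fun do rewrite mxE.
  by apply: CkD; [exact: Ck_coord|exact: Ck_cst].
rewrite /gaussian_slope subrr {2}/expR_quot eqxx.
exact: (cvgM (cvgM (cvg_cst _) cE) (cvgM (cvg_cst _) cL)).
Qed.

Lemma gaussian_slope_le (R : realType) (n : nat) (Q D : 'M[R]_n)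
    (x v : 'cV[R]_n) : is_diag_mx D -> (forall l, 0 <= D l l) ->
  `|\sum_m gaussian_slope (Q *m D *m Q^T) x x m * v m 0| <=
    \sum_m coef_bound Q D m * `|v m 0|.
Proof.
move=> hD D0.
rewrite (eq_bigr (fun m => - gaussian (Q *m D *m Q^T) x *
    ((x^T *m (Q *m D *m Q^T)) 0 m * v m 0))) => [|m _]; last first.
  by rewrite gaussian_slope_diag mulNr -mulrA mulNr.
rewrite -mulr_sumr -qform_rowE normrM normrN mulrC.
rewrite [X in _ * X]ger0_norm ?expR_ge0//; exact: qform_gaussian_le.
Qed.

(* Makes matrices a [completeNormedModType], which is not inferred otherwise. *)
HB.instance Definition _ (R : realType) (m n : nat) := Complete.on 'M[R]_(m, n).

Lemma posdef_qform_invmx_ge0 (R : realType) (n : nat) (A : 'M[R]_n)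
    (u : 'cV[R]_n) : posdef A -> 0 <= qform (invmx A) u u.
Proof.
move=> [/is_hermitianmxP]; rewrite expr0 scale1r map_mx_id// => Asym Apos.
have A0 v : 0 <= qform A v v.
  have [->|v0] := eqVneq v 0; last exact/ltW/Apos.
  by rewrite /qform mulmx0 mxE.
(* By convention [invmx] returns a singular matrix unchanged, so that case is [A0] itself. *)
have [uA|uA] := boolP (A \in unitmx); last by rewrite /invmx (negPf uA).
have -> : qform (invmx A) u u = qform A (invmx A *m u) (invmx A *m u).
  by rewrite /qform trmx_mul trmx_inv -Asym -!mulmxA mulKVmx.
exact: A0.
Qed.

(** * The sup norm on column vectors and its weighted versions *)

Lemma normr_coord_le (R : realType) (n : nat) (v : 'cV[R]_n) j : `|v j 0| <= `|v|.
Proof.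
by rewrite [leRHS]/Num.Def.normr/= mx_normrE; exact: (le_bigmax _ _ (j, 0)).
Qed.

Lemma normr_col_le (R : realType) (n : nat) (v : 'cV[R]_n) (e : R) :
  0 <= e -> (forall j, `|v j 0| <= e) -> `|v| <= e.
Proof.
move=> e0 ve; rewrite [leLHS]/Num.Def.normr/= mx_normrE.
by apply: bigmax_le => // -[j i] _; rewrite (ord1 i).
Qed.

(** Encodes the weighted norm [max_j |b j * v j 0|] as the sup norm of a rescaled vector. *)
Definition wscale (R : realType) (n : nat) (b : 'I_n -> R) (v : 'cV[R]_n) :
  'cV[R]_n := \col_j (b j * v j 0).

Lemma wscaleD (R : realType) (n : nat) (b : 'I_n -> R) (u v : 'cV[R]_n) :
  wscale b (u + v) = wscale b u + wscale b v.
Proof. by apply/colP => j; rewrite !mxE mulrDr. Qed.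

Lemma wscaleVK (R : realType) (n : nat) (b : 'I_n -> R) : (forall j, b j != 0) ->
  cancel (wscale (fun j => (b j)^-1)) (wscale b).
Proof. by move=> b0 v; apply/colP => j; rewrite !mxE mulVKf. Qed.

Lemma wscaleK (R : realType) (n : nat) (b : 'I_n -> R) : (forall j, b j != 0) ->
  cancel (wscale b) (wscale (fun j => (b j)^-1)).
Proof. by move=> b0 v; apply/colP => j; rewrite !mxE mulKf. Qed.

Lemma continuous_wscale (R : realType) (n : nat) (b : 'I_n -> R) :
  continuous (wscale b).
Proof.
apply: continuous_mx => j i; under eq_fun do rewrite mxE.
apply: (Ck_continuous (k := 0)).
by apply: CkM; [exact: Ck_cst|exact: Ck_coord].
Qed.

(** Conjugating [f] by the rescaling gives a contraction for the plain sup norm; the inverse found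
    there is conjugated back. *)
Lemma id_add_weighted_contraction_inverse (R : realType) (n : nat) (q : R)
    (b : 'I_n -> R) (f : 'cV[R]_n -> 'cV[R]_n) :
  (forall j, b j != 0) -> 0 <= q -> q < 1 ->
  (forall x y, `|wscale b (f x) - wscale b (f y)| <= q * `|wscale b x - wscale b y|) ->
  exists g : 'cV[R]_n -> 'cV[R]_n, [/\ cancel (fun x => x + f x) g,
    cancel g (fun x => x + f x) & continuous g].
Proof.
move=> b0 q0 q1 fq; pose b' j := (b j)^-1.
have [|g [gK Kg cg]] := @id_add_contraction_inverse R 'cV[R]_n q
    (fun z => wscale b (f (wscale b' z))) q0 q1.
  by move=> x y; apply: (le_trans (fq _ _)); rewrite !wscaleVK.
exists (wscale b' \o g \o wscale b); split=> [x|y|].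
- by rewrite /= wscaleD -{2}(wscaleK b0 x) gK wscaleK.
- apply: (can_inj (wscaleK b0)); rewrite wscaleD /= wscaleVK//; exact: Kg.
- have cb (a : 'I_n -> R) z : {for z, continuous (wscale a)}.
    exact: continuous_wscale.
  by move=> x; exact: continuous_comp (continuous_comp (cb b x) (cg _)) (cb b' _).
Qed.

(** * The Caratheodory factor of [phi], whose diagonal is the Jacobian *)

Definition phi_slope (R : realType) (n N : nat) (S : 'M[R]_n)
    (c : 'I_N -> 'cV[R]_n) (w : 'I_N -> 'I_n -> R) (x x' : 'cV[R]_n) : 'M[R]_n :=
  1%:M + \matrix_(j, m) \sum_i w i j * gaussian_slope S (x - c i) (x' - c i) m.

Section phi_slope_theory.
Variables (R : realType) (n N : nat) (Sigma : 'M[R]_n).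
Variables (c : 'I_N -> 'cV[R]_n) (w : 'I_N -> 'I_n -> R).
Let S := invmx Sigma.

Lemma phi_slope_mulmx (x x' v : 'cV[R]_n) j :
  (phi_slope S c w x x' *m v) j 0 = v j 0 +
  \sum_i w i j * \sum_m gaussian_slope S (x - c i) (x' - c i) m * v m 0.
Proof.
rewrite mulmxDl mul1mx mxE; congr (_ + _); rewrite mxE.
under eq_bigr do rewrite mxE mulr_suml.
rewrite exchange_big/=; apply: eq_bigr => i _; rewrite mulr_sumr.
by apply: eq_bigr => m _; rewrite mulrA.
Qed.

Lemma phiB (x x' : 'cV[R]_n) : S^T = S ->
  phi Sigma c w x' - phi Sigma c w x = phi_slope S c w x x' *m (x' - x).
Proof.
move=> Ssym; apply/colP => j; rewrite phi_slope_mulmx !mxE opprD addrACA.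
congr (_ + _); rewrite /psi -sumrB; apply: eq_bigr => i _.
rewrite -mulrBr !gaussian_kernelE gaussian_slopeE//.
by have -> : x' - c i - (x - c i) = x' - x by rewrite opprB addrA subrK.
Qed.

Lemma cvg_phi_slope (x : 'cV[R]_n) j m :
  phi_slope S c w x x' j m @[x' --> x] --> phi_slope S c w x x j m.
Proof.
have cs i : w i j * gaussian_slope S (x - c i) (x' - c i) m @[x' --> x] -->
    w i j * gaussian_slope S (x - c i) (x - c i) m.
  have ct : x' - c i @[x' --> x] --> x - c i.
    exact: (cvgB (@cvg_id _ (nbhs x)) (cvg_cst (c i))).
  have cg : gaussian_slope S (x - c i) (x' - c i) m @[x' --> x] -->
      gaussian_slope S (x - c i) (x - c i) m.
    exact: (cvg_comp _ _ ct (@cvg_gaussian_slope R n S (x - c i) m)).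
  exact: (cvgM (cvg_cst _) cg).
rewrite !mxE; under eq_fun do rewrite !mxE.
have csum : \sum_i w i j * gaussian_slope S (x - c i) (x' - c i) m @[x' --> x] -->
    \sum_i w i j * gaussian_slope S (x - c i) (x - c i) m.
  exact: (@cvg_big R 'I_N +%R 0 xpredT (@add_continuous R) _ (nbhs x) (index_enum _)
    (fun i x' => w i j * gaussian_slope S (x - c i) (x' - c i) m) _ (nbhs_filter x)
    (fun i _ => cs i)).
exact: (cvgD (cvg_cst _) csum).
Qed.

Lemma Ck_phi_slope_diag k (g : 'cV[R]_n -> 'cV[R]_n) j m :
  (forall j, Ck k (fun y => g y j 0)) ->
  Ck k (fun y => phi_slope S c w (g y) (g y) j m).
Proof.
move=> Cg; under eq_fun do rewrite !mxE; apply: CkD; first exact: Ck_cst.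
apply: Ck_sum => i _; apply: CkM; first exact: Ck_cst.
apply: (Ck_gaussian_slope_diag S (g := fun y => g y - c i)) => l.
by under eq_fun do rewrite !mxE; apply: CkD => //; exact: Ck_cst.
Qed.

Lemma Ck_phi k j : Ck k (fun x => phi Sigma c w x j 0).
Proof.
under eq_fun do rewrite !mxE; apply: CkD; first exact: Ck_coord.
apply: Ck_sum => i _; apply: CkM; first exact: Ck_cst.
apply: (Ck_gaussian S (g := fun x => x - c i)) => l.
by under eq_fun do rewrite !mxE; apply: CkD; [exact: Ck_coord|exact: Ck_cst].
Qed.

End phi_slope_theory.

(** The form of [invmx Sigma] at the [l]-th column of [Q] equals [D l l]. *)
Lemma eigenvalue_ge0 (R : realType) (n : nat) (Sigma Q D : 'M[R]_n) l :
  posdef Sigma -> Q^T *m Q = 1%:M -> invmx Sigma = Q *m D *m Q^T -> 0 <= D l l.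
Proof.
move=> Spos hQ SE; have := posdef_qform_invmx_ge0 (Q *m delta_mx l 0) Spos.
rewrite /qform SE trmx_mul !mulmxA -(mulmxA _ Q^T Q) hQ mulmx1.
rewrite -(mulmxA _ Q^T Q) hQ mulmx1 trmx_delta -rowE -colE.
by rewrite !mxE.
Qed.

(** * The contraction rate under the bound on the weights *)

Section weights.
Variables (R : realType) (n N : nat) (b : 'I_n -> R) (w : 'I_N -> 'I_n -> R).

(** The factor [n%:R] comes from bounding a sum of [n] terms [b m * |v m 0|] by [n] times the
    weighted norm. *)
Definition contraction_rate : R :=
  \big[Num.max/0]_j (b j * (\sum_i `|w i j| * n%:R)).

Lemma contraction_rate_ge0 : 0 <= contraction_rate.
Proof. exact: bigmax_ge_id. Qed.

Lemma contraction_rate_lt1 : (1 <= n)%N -> (1 <= N)%N -> (forall j, 0 < b j) ->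
  (forall i j, `|w i j| < 1 / (n%:R * N%:R * b j)) -> contraction_rate < 1.
Proof.
move=> n0 N0 b0 wb; apply: bigmax_lt => [|j _]; first exact: ltr01.
have n0' : 0 < n%:R :> R by rewrite ltr0n.
have N0' : 0 < N%:R :> R by rewrite ltr0n.
rewrite -ltr_pdivlMl// -mulr_suml -ltr_pdivlMr//.
apply: (@lt_le_trans _ _ (\sum_(i < N) 1 / (n%:R * N%:R * b j))).
  (* Strictness of the summed inequality requires at least one index, which [N0] supplies. *)
  by apply: ltr_sum => //; apply/hasP; exists (Ordinal N0); rewrite ?mem_index_enum.
rewrite sumr_const card_ord -[X in X <= _]mulr_natr le_eqVlt; apply/orP; left.
by apply/eqP; field; rewrite !gt_eqF.
Qed.

Hypothesis b0 : forall j, 0 <= b j.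

(** Stated for abstract [r] so as to serve twice: with differences of kernels for the contraction,
    and with derivatives of kernels for the Jacobian. *)
Lemma weighted_sum_le (r : 'I_N -> R) (v : 'cV[R]_n) j :
  (forall i, `|r i| <= \sum_m b m * `|v m 0|) ->
  b j * `|\sum_i w i j * r i| <= contraction_rate * `|wscale b v|.
Proof.
move=> rv.
apply: (@le_trans _ _ (b j * (\sum_i `|w i j| * n%:R) * `|wscale b v|)); last first.
  by apply: ler_wpM2r; [exact: normr_ge0|exact: (le_bigmax _ _ j)].
rewrite -mulrA; apply: ler_wpM2l => //; rewrite mulr_suml.
apply: (le_trans (ler_norm_sum _ _ _)); apply: ler_sum => i _.
rewrite normrM -mulrA; apply: ler_wpM2l; first exact: normr_ge0.
apply: (le_trans (rv i)).
rewrite mulr_natl -[X in _ *+ X]card_ord -sumr_const; apply: ler_sum => m _.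
by apply: le_trans (normr_coord_le _ m); rewrite mxE normrM ger0_norm.
Qed.

End weights.

Theorem theorem4p2 (R : realType) (n N : nat) (hn : (1 <= n)%N) (hN : (1 <= N)%N)
    (c : 'I_N -> 'cV[R]_n) (Sigma Q D : 'M[R]_n)
    (hSigma : posdef Sigma)
    (hQ : Q^T *m Q = 1%:M)
    (hD : is_diag_mx D)
    (hQD : invmx Sigma = Q *m D *m Q^T)
    (w : 'I_N -> 'I_n -> R)
    (hw : forall (i : 'I_N) (j : 'I_n),
       `|w i j| <
       1 / (n%:R * N%:R *
            \sum_(l < n) `|Q j l| * expR (- 2^-1) * Num.sqrt (D l l))) :
  diffeomorphism (phi Sigma c w).
Proof.
have D0 l : 0 <= D l l by exact: eigenvalue_ge0 hSigma hQ hQD.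
have Ssym : (Q *m D *m Q^T)^T = Q *m D *m Q^T.
  rewrite !trmx_mul trmxK mulmxA (_ : D^T = D)//.
  apply/matrixP => i j; rewrite mxE; have [->//|ij] := eqVneq i j.
  by move/is_diag_mxP: hD => hD; rewrite !hD// eq_sym.
pose b := coef_bound Q D.
(* Division by zero yields zero, so [hw] rules out [b j = 0]. *)
have b0 j : 0 < b j.
  rewrite lt_neqAle eq_sym sumr_ge0 ?andbT; last first.
    by move=> l _; rewrite !mulr_ge0 ?sqrtr_ge0 ?expR_ge0.
  apply/eqP => bj0; have := hw (Ordinal hN) j.
  by rewrite -/(coef_bound Q D j) -/b bj0 mulr0 invr0 mulr0 normr_lt0.
pose q := contraction_rate b w.
have q0 : 0 <= q by exact: contraction_rate_ge0.
have q1 : q < 1 by exact: contraction_rate_lt1.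
have bn0 j : b j != 0 by rewrite gt_eqF.
have b0' j : 0 <= b j by exact: ltW.
have [|g [gK Kg cg]] := id_add_weighted_contraction_inverse
    (f := fun x => \col_j psi Sigma c w j x) bn0 q0 q1.
  move=> x y.
  have -> : wscale b x - wscale b y = wscale b (x - y).
    by apply/colP => j; rewrite !mxE mulrBr.
  apply: normr_col_le => [|j]; first exact: mulr_ge0.
  rewrite !mxE -mulrBr normrM ger0_norm// /psi -sumrB.
  under eq_bigr do rewrite -mulrBr.
  apply: weighted_sum_le => // i.
  rewrite !gaussian_kernelE hQD.
  (* Translating by the center leaves the difference unchanged, so one Lipschitz bound covers all
     kernels. *)
  have -> : x - y = (x - c i) - (y - c i) by rewrite opprB addrA subrK.
  exact: gaussian_lipschitz.
pose S := invmx Sigma.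
(* A kernel vector [v] of the Jacobian equals minus the derivative of the perturbation applied to
   [v], so its weighted norm is at most [q] times itself and [v] vanishes. *)
have uM x : phi_slope S c w x x \in unitmx.
  apply: unitmx_inj => v Mv.
  have vE j : v j 0 = - \sum_i w i j *
      \sum_m gaussian_slope S (x - c i) (x - c i) m * v m 0.
    by apply/eqP; rewrite -addr_eq0 -phi_slope_mulmx Mv mxE.
  have : `|wscale b v| <= q * `|wscale b v|.
    apply: normr_col_le => [|j]; first exact: mulr_ge0.
    rewrite mxE vE normrM normrN ger0_norm//.
    apply: weighted_sum_le => // i; rewrite /S hQD; exact: gaussian_slope_le.
  rewrite -subr_ge0 -{2}[`|wscale b v|]mul1r -mulrBl nmulr_rge0 ?subr_lt0//.
  rewrite normr_le0 => /eqP bv0; rewrite -(wscaleK bn0 v) bv0.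
  by apply/colP => j; rewrite !mxE mulr0.
split; first by move=> k; apply: is_Ck_coord => j; exact: Ck_phi.
exists g; split=> // k; apply: is_Ck_coord => j.
apply: (Ck_inverse (f := phi Sigma c w) (M := phi_slope S c w)) => //.
- by move=> x x'; apply: phiB; rewrite hQD.
- exact: cvg_phi_slope.
- by move=> l gC i m; exact: Ck_phi_slope_diag.
Qed.
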